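(* Let $(X_t)_{t \in \mathbb{N}}$ be a random process over $\mathbb{R}$, and let $T = \inf\{t \mid X_t \leq 0\}$. Furthermore, suppose that, (a) for all $t \leq T$, it holds that $X_t \geq 0$, and that (b) there is some value $\delta > 0$ such that, for all $t < T$, it holds that $X_t - \mathrm{E}[X_{t+1} \mid X_0, \ldots, X_t] \geq \delta$. Then $$\mathrm{E}[T \mid X_0] \leq \frac{X_0}{\delta}.$$
   Context: $\mathbb{N}$ includes $0$. $\inf\emptyset := \infty$, so $T$ takes values in $\mathbb{N} \cup \{\infty\}$. Conditional expectations given $X_0,\ldots,X_t$ (respectively $X_0$) are random variables, taken with respect to the $\sigma$-algebra generated by these variables; (in)equalities between random variables are understood almost surely. Since $T$ is a random variable, a requirement stated ''for all $t < T$'' (respectively ''for all $t \le T$'') means formally that, for every $t \in \mathbb{N}$, both sides of the inequality are multiplied by the indicator function of the event $\{t < T\}$ (respectively $\{t \le T\}$); i.e., the inequality only has to hold on that event. *)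

(* Defs.v *)
From HB Require Import structures.
From mathcomp Require Import all_boot all_order all_algebra.
From mathcomp Require Import all_classical all_reals all_analysis.
From mathcomp Require Import measurable_realfun.

Set Implicit Arguments.
Unset Strict Implicit.
Unset Printing Implicit Defensive.

Import Order.TTheory GRing.Theory Num.Theory.
Import numFieldNormedType.Exports.

Local Open Scope classical_set_scope.
Local Open Scope ring_scope.
Local Open Scope ereal_scope.

Section conditional_expectation.
Context d (T : measurableType d) (R : realType) (P : probability T R).
(* G is any family of measurable sets generating the conditioning
   sigma-algebra <<s G >>. *)
Variable G : set (set T).

(* Z is a version of E[Y | <<s G >>], for Y >= 0 not necessarily integrable. *)
Definition ge0_condexp_version (Y Z : T -> \bar R) : Prop :=
  [/\ forall w, 0 <= Z w,
      measurable_fun [set: g_sigma_algebraType G]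
        (Z : g_sigma_algebraType G -> \bar R) &
      forall A, <<s G >> A ->
        \int[P]_(w in A) Z w = \int[P]_(w in A) Y w].

(* An arbitrary version: one exists (ge0_condexpP below), and any two agree
   almost surely (ge0_condexp_version_ae_eq below). *)
Definition ge0_condexp (Y : T -> \bar R) : T -> \bar R :=
  xget (cst 0) (ge0_condexp_version Y).

(* No integrability is assumed: E[Y | G] = E[Y^+ | G] - E[Y^- | G], which is the
   usual conditional expectation wherever one of the two terms is finite.  Where
   both are infinite the value is -oo by the convention +oo - oo = -oo. *)
Definition condexp (Y : T -> \bar R) : T -> \bar R :=
  ge0_condexp Y^\+ \- ge0_condexp Y^\-.

End conditional_expectation.

Section first_hitting_time.
Context d (T : measurableType d) (R : realType) (P : probability T R).
Variable X : nat -> {RV P >-> R}.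

Definition history (t : nat) : set (set T) :=
  g_sigma_preimage (fun i : 'I_t.+1 => X i : T -> R).

(* The infimum is taken in \bar R, where the infimum of set0 is +oo. *)
Definition hitting_time (w : T) : \bar R :=
  ereal_inf [set t%:R%:E | t in [set t | (X t w <= 0)%R]].

End first_hitting_time.

Section conditional_expectation_facts.
Context d (T : measurableType d) (R : realType) (P : probability T R).
Variable G : set (set T).
Hypothesis GT : G `<=` measurable.

Let sG (A : set T) : <<s G >> A -> measurable A.
Proof.
by apply: smallest_sub => //; exact: sigma_algebra_measurable.
Qed.

Let sG_fun (Z : T -> \bar R) :
  measurable_fun [set: g_sigma_algebraType G]
    (Z : g_sigma_algebraType G -> \bar R) ->
  measurable_fun setT Z.
Proof. by move=> mZ _ A mA; apply: sG; exact: mZ. Qed.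

Let GT_fun : measurable_fun [set: T] (idfun : T -> g_sigma_algebraType G).
Proof. by move=> _ A mA; rewrite setTI; exact: sG. Qed.

Let idG : {mfun T >-> g_sigma_algebraType G} :=
  HB.pack (idfun : T -> g_sigma_algebraType G)
    (isMeasurableFun.Build _ _ T (g_sigma_algebraType G) _ GT_fun).

Let PG : probability (g_sigma_algebraType G) R := distribution P idG.

Section bounded.
Variable f : T -> R.
Hypothesis mf : measurable_fun setT f.
Hypothesis f01 : forall w, (0 <= f w <= 1)%R.

Let f0 w : 0 <= (f w)%:E.
Proof. by rewrite lee_fin; case/andP: (f01 w). Qed.

Let mfE A : measurable_fun A (EFin \o f).
Proof. by apply/measurable_EFinP; exact: measurable_funTS. Qed.

Let nu (A : set (g_sigma_algebraType G)) : \bar R := \int[P]_(w in A) (f w)%:E.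

Let nu0 : nu set0 = 0.
Proof. by rewrite /nu integral_set0. Qed.

Let nu_ge0 A : 0 <= nu A.
Proof. exact: integral_ge0. Qed.

Let nu_sigma_additive : semi_sigma_additive nu.
Proof.
move=> F mF tF mUF; rewrite /nu ge0_integral_bigcup//.
- by apply: is_cvg_nneseries => // n _ _; exact: integral_ge0.
by move=> k; exact: sG (mF k).
Qed.

Let nu_measure : {measure set (g_sigma_algebraType G) -> \bar R} :=
  HB.pack nu (isMeasure.Build _ (g_sigma_algebraType G) R nu
    nu0 nu_ge0 nu_sigma_additive).

Let nu_fin : fin_num_fun nu.
Proof.
move=> A mA; rewrite ge0_fin_numE//.
have mA' : measurable (A : set T) by exact: sG.
apply: (@le_lt_trans _ _ (\int[P]_(w in A) (cst 1 w))).
  apply: ge0_le_integral => //.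
  by move=> w _; rewrite lee_fin; case/andP: (f01 w).
rewrite integral_cst// mul1e (le_lt_trans (probability_le1 _ _))//.
exact: ltry.
Qed.

Let nu_finite : {finite_measure set (g_sigma_algebraType G) -> \bar R} :=
  HB.pack nu (Measure.on nu_measure)
    (Measure_isFinite.Build _ (g_sigma_algebraType G) R nu_measure nu_fin).

Lemma bounded_condexp_exists : exists Z, ge0_condexp_version P G (EFin \o f) Z.
Proof.
have dom : nu `<< PG.
  apply/null_content_dominatesP => A mA PA0.
  by apply: null_set_integral => //; exact: sG.
have [g [g0 gfin gint gE]] := @radon_nikodym_sigma_finite _ _ _ PG nu_finite dom.
have mg := measurable_int _ gint.
exists g; split => // A sA.
have := gE A sA; rewrite /PG.
rewrite (@ge0_integral_pushforward _ _ _ _ _ _ GT_fun P A g)//.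
exact: measurable_funTS.
Qed.
End bounded.

Lemma ge0_condexp_exists (Y : T -> \bar R) : measurable_fun setT Y ->
  (forall w, 0 <= Y w) -> exists Z, ge0_condexp_version P G Y Z.
Proof.
move=> mY Y0.
pose m n w := fine (mine (Y w) n%:R%:E).
have mE n w : (m n w)%:E = mine (Y w) n%:R%:E.
  rewrite fineK// fin_numE; apply/andP; split.
    by rewrite -ltNye lt_min ltNyr (lt_le_trans _ (Y0 w)).
  by rewrite -ltey gt_min ltry orbT.
pose f n w := (m n.+1 w - m n w)%R.
have f01 n w : (0 <= f n w <= 1)%R.
  rewrite subr_ge0 lerBlDl -!lee_fin EFinD !mE; apply/andP; split.
    by rewrite le_min !ge_min lexx/= lee_fin ler_nat leqnSn orbT.
  have [Yn|nY] := leP (Y w) n%:R%:E.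
    by rewrite ge_min leeDl// lee01.
  by rewrite -EFinD -natr1 ge_min lexx orbT.
have mf n : measurable_fun setT (f n).
  apply: measurable_funB; apply: measurableT_comp => //;
    by apply: measurable_mine.
have fY w : \sum_(n <oo) (f n w)%:E = Y w.
  rewrite (_ : (fun n => _) = (fun n => (m n w)%:E)); last first.
    apply/funext => n; rewrite sumEFin telescope_sumr//.
    suff -> : m 0%N w = 0%R by rewrite subr0.
    by apply: EFin_inj; rewrite mE; apply/min_idPr.
  apply/cvg_lim => //.
  under eq_fun do rewrite mE.
  case: (Y w) (Y0 w) => [r| |//] r0.
    apply: cvg_near_cst; near=> n; apply/min_idPl; rewrite lee_fin.
    by near: n; exact: nbhs_infty_ger.
  under eq_fun do rewrite (min_idPr (leey _)).
  by apply/cvgeryP; exact: cvgr_idn.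
have [Z ZP] := choice (fun n => bounded_condexp_exists (mf n) (f01 n)).
have Z0 n w : 0 <= Z n w by have [] := ZP n.
have mZ n : @measurable_fun _ _ (g_sigma_algebraType G) _ setT (Z n).
  by have [] := ZP n.
exists (fun w => \sum_(n <oo) Z n w); split.
- by move=> w; exact: nneseries_ge0.
- exact: (@ge0_emeasurable_sum _ (g_sigma_algebraType G)).
- move=> A sA; have mA := sG sA.
  rewrite integral_nneseries//; last first.
    by move=> n; apply: measurable_funTS; exact: sG_fun (mZ n).
  have ZE n : \int[P]_(w in A) Z n w = \int[P]_(w in A) (f n w)%:E.
    by have [_ _ ->] := ZP n.
  under eq_eseriesr do rewrite ZE.
  rewrite -integral_nneseries//.
  + by apply: eq_integral => w _; exact: fY.
  + by move=> n; apply/measurable_EFinP; exact: measurable_funTS.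
  + by move=> n w _; rewrite lee_fin; case/andP: (f01 n w).
Unshelve. all: end_near. Qed.

Lemma ge0_condexpP (Y : T -> \bar R) : measurable_fun setT Y ->
  (forall w, 0 <= Y w) -> ge0_condexp_version P G Y (ge0_condexp P G Y).
Proof.
by move=> mY Y0; have [Z] := ge0_condexp_exists mY Y0; exact: xgetI.
Qed.

Lemma ge0_condexp_version_ae_eq (Y Z1 Z2 : T -> \bar R) :
  ge0_condexp_version P G Y Z1 -> ge0_condexp_version P G Y Z2 ->
  {ae P, forall w, Z1 w = Z2 w}.
Proof.
suff H U V : ge0_condexp_version P G Y U -> ge0_condexp_version P G Y V ->
    {ae P, forall w, U w <= V w}.
  move=> v1 v2; have := H _ _ v2 v1; have := H _ _ v1 v2.
  by apply: filterS2 => w le12 le21; apply/eqP; rewrite eq_le le12 le21.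
move=> [U0 mU UE] [V0 mV VE].
have mU' := sG_fun mU; have mV' := sG_fun mV.
pose N n := [set w | V w < U w] `&` [set w | V w <= n%:R%:E].
have sN n : <<s G >> (N n).
  have mVU := @measurable_lte _ (g_sigma_algebraType G) _ setT measurableT V U
    mV mU.
  have mVn := @measurable_lee _ (g_sigma_algebraType G) _ setT measurableT V
    (cst n%:R%:E) mV (measurable_cst _).
  have := @measurableI _ (g_sigma_algebraType G) _ _ mVU mVn.
  by rewrite !setTI.
have N0 n : P (N n) = 0.
  have mN := sG (sN n).
  have Vfin w : N n w -> V w \is a fin_num.
    by move=> [_ /= Vn]; rewrite ge0_fin_numE// (le_lt_trans Vn)// ltry.
  have UV0 w : N n w -> 0 <= U w - V w.
    by move=> Nw; rewrite sube_ge0 ?Vfin// ltW//; case: Nw.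
  have mUV : measurable_fun (N n) (U \- V).
    by apply: emeasurable_funB; exact: measurable_funTS.
  have Vlty : \int[P]_(w in N n) V w < +oo.
    apply: (@le_lt_trans _ _ (\int[P]_(w in N n) cst n%:R%:E w)).
      apply: ge0_le_integral => //; first exact: measurable_funTS.
      by move=> w [].
    rewrite integral_cst//.
    by rewrite lte_mul_pinfty// (le_lt_trans (probability_le1 _ _))// ltry.
  have : \int[P]_(w in N n) (U w - V w) = 0.
    have := UE _ (sN n); rewrite -VE//.
    rewrite (eq_integral (fun w => (U w - V w) + V w)); last first.
      by move=> w; rewrite inE => Nw; rewrite subeK// Vfin.
    rewrite ge0_integralD//; last exact: measurable_funTS.
    have Vint : \int[P]_(w in N n) V w \is a fin_num.
      by rewrite ge0_fin_numE// integral_ge0.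
    by move=> UVV; rewrite -[LHS](addeK _ Vint) UVV subee.
  rewrite (eq_integral (fun w => `|U w - V w|)); last first.
    by move=> w; rewrite inE => Nw; rewrite gee0_abs// UV0.
  move=> /(ae_eq_integral_abs _ mN mUV) [B [mB PB0 sB]].
  apply/eqP; rewrite -measure_le0 -PB0 le_measure ?inE// => w Nw.
  apply: sB => /= /(_ Nw) UV.
  by case: Nw => /= + _; rewrite -sube_gt0 UV ltxx.
have : P.-negligible (\bigcup_n N n).
  apply: negligible_bigcup => n; apply/negligibleP; last exact: N0.
  exact: sG.
apply: negligibleS => w /= /negP; rewrite -ltNge => VU.
have Vfin : V w \is a fin_num by rewrite ge0_fin_numE// (lt_le_trans VU) ?leey.
exists (Num.truncn (fine (V w))).+1 => //; split=> //=.
by rewrite -(fineK Vfin) lee_fin ltW// truncnS_gt.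
Qed.

End conditional_expectation_facts.

(* Main.v *)
Require Import Defs.
From mathcomp Require Import all_boot all_order all_algebra.
From mathcomp Require Import all_classical all_reals all_analysis.
From mathcomp Require Import measurable_realfun.

Import Order.TTheory GRing.Theory Num.Theory.
Import numFieldNormedType.Exports.

Local Open Scope classical_set_scope.
Local Open Scope ring_scope.
Local Open Scope ereal_scope.

(** Write S_t for the event {t < T} that the process is still positive at
    times 0, ..., t, and X^+ for the positive part.  The event S_t is
    determined by X_0, ..., X_t, and so is every event A determined by X_0
    alone.  Integrating the drift inequality over the intersection of A and
    S_t, and replacing the conditional expectation of X_{t+1}^+ by X_{t+1}^+
    itself, gives

      E[X_{t+1}^+ ; A, S_t] + delta P(A, S_t) <= E[X_t^+ ; A, S_t].

    As S_{t+1} is included in S_t and X_{t+1}^+ >= 0, the first term only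
    decreases when S_t is replaced by S_{t+1} ([drift_step]), and the resulting
    inequalities telescope ([drift_telescope]) into

      delta (P(A, S_0) + ... + P(A, S_{n-1})) <= E[X_0^+ ; A].

    The time T is the sum of the indicators of the S_t
    ([hitting_time_series]), so n -> oo yields E[T ; A] <= E[X_0^+ / delta ; A]
    for every such A ([integral_hitting_time_le]), which is the conditional
    inequality ([le_integral_ae_le]), because X_0 = X_0^+ almost surely.

    No X_t is assumed integrable.  Every inequality above is kept additive, in
    the form a + b <= c with nonnegative extended reals, so that nothing is
    ever cancelled.  The negative part of X_{t+1} is disposed of before
    integrating: X_{t+1} is almost surely nonnegative on S_t, because
    t + 1 <= T there, and therefore E[X_{t+1} | X_0, ..., X_t] is
    E[X_{t+1}^+ | X_0, ..., X_t] on S_t ([condexp_ae_ge0]). *)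

(** * Comparing conditional expectations *)

Section conditional_expectation_comparison.
Context {d} {T : measurableType d} {R : realType} (P : probability T R).
Context {G : set (set T)} (GT : G `<=` measurable).

Lemma measurable_generated (A : set T) : <<s G >> A -> measurable A.
Proof.
by apply: smallest_sub => //; exact: sigma_algebra_measurable.
Qed.

Lemma measurable_fun_generated (Z : T -> \bar R) :
  measurable_fun [set: g_sigma_algebraType G]
    (Z : g_sigma_algebraType G -> \bar R) ->
  measurable_fun setT Z.
Proof. by move=> mZ _ A mA; apply: measurable_generated; exact: mZ. Qed.

(** Let N be the event {V < U}.  On the events included in N the integrals of
    U and V are also ordered the other way, hence equal, so that U and V
    restricted to N are two versions of one conditional expectation.  These
    agree almost surely, although they differ everywhere on N: thus N is
    negligible. *)
Lemma le_integral_ae_le (U V : T -> \bar R) :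
  (forall w, 0 <= U w) -> (forall w, 0 <= V w) ->
  measurable_fun [set: g_sigma_algebraType G]
    (U : g_sigma_algebraType G -> \bar R) ->
  measurable_fun [set: g_sigma_algebraType G]
    (V : g_sigma_algebraType G -> \bar R) ->
  (forall A, <<s G >> A -> \int[P]_(w in A) U w <= \int[P]_(w in A) V w) ->
  {ae P, forall w, U w <= V w}.
Proof.
move=> U0 V0 mU mV UV.
pose N := [set w | V w < U w].
have sN : <<s G >> N.
  have := @measurable_lte _ (g_sigma_algebraType G) _ setT measurableT V U
    mV mU.
  by rewrite setTI.
have version_restr W : (forall w, 0 <= W w) ->
    measurable_fun [set: g_sigma_algebraType G]
      (W : g_sigma_algebraType G -> \bar R) ->
    (forall A, <<s G >> A ->
      \int[P]_(w in A `&` N) W w = \int[P]_(w in A `&` N) V w) ->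
    ge0_condexp_version P G (V \_ N) (W \_ N).
  move=> W0 mW WV; split.
  - by move=> w; rewrite patchE; case: ifP.
  - apply: (@measurable_restrictT _ _ (g_sigma_algebraType G) _ N W sN).1.
    exact: measurable_funTS.
  - by move=> A sA; rewrite -!integral_mkcondr WV.
have UN : ge0_condexp_version P G (V \_ N) (U \_ N).
  apply: version_restr => // A sA.
  have sAN : <<s G >> (A `&` N).
    exact: (@measurableI _ (g_sigma_algebraType G)).
  apply/eqP; rewrite eq_le UV//=; apply: ge0_le_integral => //.
  - exact: measurable_generated.
  - by apply: measurable_funTS; exact: measurable_fun_generated.
  - by apply: measurable_funTS; exact: measurable_fun_generated.
  - by move=> w [_ /ltW].
have VN : ge0_condexp_version P G (V \_ N) (V \_ N) by exact: version_restr.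
have := ge0_condexp_version_ae_eq GT UN VN.
apply: filterS => w; rewrite !patchE; case: ifPn => [_ -> //|].
by rewrite notin_setE/= => /negP; rewrite -leNgt.
Qed.

(** The conditional expectation of the negative part of Y integrates to 0 over
    A, so it vanishes almost surely there; A has to be an event of the
    conditioning sigma-algebra for this integral to be that of Y^-. *)
Lemma condexp_ae_ge0 (Y : T -> \bar R) (A : set T) :
  measurable_fun setT Y -> <<s G >> A ->
  {ae P, forall w, A w -> 0 <= Y w} ->
  {ae P, forall w, A w -> condexp P G Y w = ge0_condexp P G Y^\+ w}.
Proof.
move=> mY sA Y0.
have mA := measurable_generated _ sA.
have [Z0 mZ ZE] :=
  ge0_condexpP P GT (measurable_funeneg mY) (@funeneg_ge0 _ _ Y).
have mZ' := measurable_fun_generated _ mZ.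
have : \int[P]_(w in A) `|ge0_condexp P G Y^\- w| = 0.
  under eq_integral do rewrite gee0_abs//.
  rewrite ZE//; rewrite -(integral0 P A); apply: ge0_ae_eq_integral => //.
  - by apply: measurable_funTS; exact: measurable_funeneg.
  - apply: filterS Y0 => w Y0 Aw; rewrite funenegE; apply/max_idPr.
    by rewrite leeNl oppe0 Y0.
move/(ae_eq_integral_abs P mA (measurable_funTS mZ')).
by apply: filterS => w Z_eq0 Aw; rewrite /condexp Z_eq0//= sube0.
Qed.

End conditional_expectation_comparison.

(** * The events of survival beyond a given time *)

Lemma nneseries_indic_lt (R : realType) (k : nat) :
  \sum_(t <oo) ((t < k)%N%:R)%:E = k%:R%:E :> \bar R.
Proof.
apply/cvg_lim => //; apply: cvg_near_cst; near=> n.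
rewrite sumEFin -natr_sum; congr (_%:R%:E).
have kn : (k <= n)%N by near: n; exact: nbhs_infty_ge.
rewrite (big_cat_nat _ kn)//= big_nat (eq_bigr (fun=> 1%N)); last first.
  by move=> t /andP[_ ->].
rewrite -big_nat sum_nat_const_nat subn0 muln1.
rewrite big_nat big1 ?addn0// => t /andP[kt _].
by rewrite ltnNge kt.
Unshelve. all: end_near. Qed.

Section survival.
Context {d} {T : measurableType d} {R : realType} {P : probability T R}.
Variable X : nat -> {RV P >-> R}.

Definition survival (t : nat) : set T := [set w | t%:R%:E < hitting_time X w].

Lemma survivalP t w :
  survival t w <-> forall i, (i <= t)%N -> (0 < X i w)%R.
Proof.
split=> [tT i it|X0].
  rewrite ltNge; apply/negP => Xi; move: tT; rewrite /survival/= ltNge => /negP.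
  apply; apply: (@le_trans _ _ i%:R%:E); last by rewrite lee_fin ler_nat.
  by apply: ereal_inf_lbound; exists i.
apply: (@lt_le_trans _ _ t.+1%:R%:E); first by rewrite lte_fin ltr_nat.
apply: le_ereal_inf_tmp => _ [i /= Xi <-]; rewrite lee_fin ler_nat ltnNge.
by apply/negP => /X0; rewrite ltNge Xi.
Qed.

(** Finite values of T are integers.  Hence, after surviving time t, the process
    is still subject at time t + 1 to a hypothesis made for all times up to and
    including T. *)
Lemma survival_leS t w : survival t w -> t.+1%:R%:E <= hitting_time X w.
Proof.
move/survivalP => X0; apply: le_ereal_inf_tmp => _ [i /= Xi <-].
rewrite lee_fin ler_nat ltnNge.
by apply/negP => /X0; rewrite ltNge Xi.
Qed.

Lemma survivalS t : survival t.+1 `<=` survival t.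
Proof.
by move=> w /survivalP X0; apply/survivalP => i /leqW; exact: X0.
Qed.

Lemma hitting_time_ge0 w : 0 <= hitting_time X w.
Proof. by apply: le_ereal_inf_tmp => _ [i /= Xi <-]; rewrite lee_fin. Qed.

(** Unlike T itself, whose infimum looks at the whole trajectory, each term of
    this series depends on finitely many X_i. *)
Lemma hitting_time_series w :
  hitting_time X w = \sum_(t <oo) (\1_(survival t) w)%:E.
Proof.
have [[k Xk]|noX] := pselect (exists k, (X k w <= 0)%R).
  have [m Xm mmin] := ex_minnP (ex_intro (fun k => (X k w <= 0)%R) k Xk).
  have -> : hitting_time X w = m%:R%:E.
    apply/eqP; rewrite eq_le; apply/andP; split.
      by apply: ereal_inf_lbound; exists m.
    by apply: le_ereal_inf_tmp => _ [i /= Xi <-]; rewrite lee_fin ler_nat mmin.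
  rewrite -nneseries_indic_lt; apply: eq_eseriesr => t _.
  rewrite indicE; congr (_%:R%:E); congr nat_of_bool.
  apply/idP/idP => [tm|].
    rewrite inE; apply/survivalP => i it; rewrite ltNge; apply/negP => /mmin.
    by rewrite leqNgt (leq_ltn_trans it tm).
  rewrite inE => /survivalP X0; rewrite ltnNge; apply/negP => /X0.
  by rewrite ltNge Xm.
have X0 i : (0 < X i w)%R.
  by rewrite ltNge; apply/negP => Xi; apply: noX; exists i.
have -> : hitting_time X w = +oo.
  rewrite /hitting_time [X in ereal_inf X](_ : _ = set0) ?ereal_inf0//.
  by rewrite -subset0 => _ [i /= + _]; rewrite leNgt X0.
apply/esym/cvg_lim => //.
rewrite (_ : (fun _ => _) = (fun n => n%:R%:E)).
  by apply/cvgeryP; exact: cvgr_idn.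
apply/funext => n; rewrite sumEFin; congr (_%:E).
rewrite (eq_bigr (fun=> 1%R)) ?sumr_const_nat ?subn0// => t _.
by rewrite indicE mem_set//; apply/survivalP.
Qed.

Lemma history_measurable t : history X t `<=` measurable.
Proof.
apply: smallest_sub; first exact: sigma_algebra_measurable.
move=> A; rewrite -bigcup_seq => -[i _ [B mB <-]].
exact: measurable_funPT.
Qed.

Lemma history_preimage t i (B : set R) : (i <= t)%N -> measurable B ->
  history X t (X i @^-1` B).
Proof.
move=> it mB; apply: sub_sigma_algebra; rewrite -bigcup_seq.
exists (Ordinal (it : (i < t.+1)%N)); first by rewrite /= mem_index_enum.
by exists B => //; rewrite setTI.
Qed.

Lemma survival_history t : <<s history X t >> (survival t).
Proof.
have -> : survival t = \bigcap_(i in `I_t.+1) (X i @^-1` `]0%R, +oo[%classic).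
  apply/seteqP; split => w.
    by move=> /survivalP X0 i /= it; rewrite in_itv/= andbT X0.
  move=> X0; apply/survivalP => i it.
  by have := X0 i it; rewrite /= in_itv/= andbT.
apply: (@fin_bigcap_measurable _ (g_sigma_algebraType (history X t))) => //.
move=> i it; apply: sub_sigma_algebra; exact: history_preimage.
Qed.

Lemma initial_sub_history t :
  <<s g_sigma_algebra_preimage (X 0%N) >> `<=` <<s history X t >>.
Proof.
apply: sub_sigma_algebra2 => A [B mB <-].
by rewrite setTI; exact: history_preimage.
Qed.

Lemma measurable_survival t : measurable (survival t).
Proof.
exact: measurable_generated (@history_measurable t) _ (survival_history t).
Qed.

Lemma measurable_hitting_time : measurable_fun setT (hitting_time X).
Proof.
rewrite (_ : hitting_time X =
    fun w => \sum_(t <oo) (\1_(survival t) w)%:E); last first.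
  by apply/funext => w; exact: hitting_time_series.
apply: ge0_emeasurable_sum => // t _.
by apply/measurable_EFinP; exact: measurable_indic (measurable_survival t).
Qed.

Lemma integral_hitting_time (A : set T) : measurable A ->
  \int[P]_(w in A) hitting_time X w = \sum_(t <oo) P (A `&` survival t).
Proof.
move=> mA; under eq_integral do rewrite hitting_time_series.
rewrite integral_nneseries//.
- apply: eq_eseriesr => t _.
  by rewrite integral_indic 1?setIC//; exact: measurable_survival.
- move=> t; apply/measurable_EFinP.
  exact: measurable_indic (measurable_survival t).
Qed.

End survival.

(** * Consequences of the drift *)

Section drift.
Context {d} {T : measurableType d} {R : realType} {P : probability T R}.
Variables (X : nat -> {RV P >-> R}) (delta : R).
Hypothesis Xge0 : forall t : nat,
  {ae P, forall w, t%:R%:E <= hitting_time X w -> (0 <= X t w)%R}.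
Hypothesis delta_gt0 : (0 < delta)%R.
Hypothesis drift : forall t : nat,
  {ae P, forall w, t%:R%:E < hitting_time X w ->
    (X t w)%:E - condexp P (history X t) (EFin \o X t.+1) w >= delta%:E}.

Local Notation pos t := ((EFin \o X t)^\+).

Lemma measurable_pos t : measurable_fun setT (pos t).
Proof. by apply: measurable_funepos; exact/measurable_EFinP. Qed.

Lemma survival_pos t w : survival X t w -> pos t w = (X t w)%:E.
Proof.
move/survivalP => /(_ t (leqnn t)) X0; rewrite funeposE/=.
by apply/max_idPl; rewrite lee_fin ltW.
Qed.

(** Only finite numbers can be moved across an inequality of extended reals;
    X_t is one, which turns the difference in the drift into a sum. *)
Lemma survival_drift t :
  {ae P, forall w, survival X t w ->
    delta%:E + ge0_condexp P (history X t) (pos t.+1) w <= pos t w}.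
Proof.
have mX : measurable_fun setT (EFin \o X t.+1) by exact/measurable_EFinP.
have X0 : {ae P, forall w, survival X t w -> 0 <= (EFin \o X t.+1) w}.
  apply: filterS (Xge0 t.+1) => w X0 /survival_leS/X0.
  by rewrite lee_fin.
have := condexp_ae_ge0 P (@history_measurable _ _ _ _ X t) _ _ mX
  (survival_history X t) X0.
apply: filterS2 (drift t) => w dr ce Sw.
by rewrite survival_pos// -lee_suber_addr// -ce// dr.
Qed.

(** Integrating [survival_drift] leaves E[X_{t+1}^+ ; A, S_t] on the left;
    shrinking S_t to S_{t+1} there makes both ends the same expression, one
    step apart. *)
Lemma drift_step t A : <<s history X t >> A ->
  \int[P]_(w in A `&` survival X t.+1) pos t.+1 w
    + delta%:E * P (A `&` survival X t)
  <= \int[P]_(w in A `&` survival X t) pos t w.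
Proof.
move=> sA.
have hm := @history_measurable _ _ _ _ X t.
have sAS : <<s history X t >> (A `&` survival X t).
  apply: (@measurableI _ (g_sigma_algebraType (history X t))) => //.
  exact: survival_history.
have mA := measurable_generated hm _ sA.
have mAS := measurable_generated hm _ sAS.
have mp := measurable_pos t.+1.
have [Z0 mZ ZE] := ge0_condexpP P hm mp (funepos_ge0 _).
have mZ' := measurable_fun_generated hm _ mZ.
have d0 : 0 <= delta%:E by rewrite lee_fin ltW.
apply: (@le_trans _ _ (\int[P]_(w in A `&` survival X t)
    (delta%:E + ge0_condexp P (history X t) (pos t.+1) w))).
  rewrite ge0_integralD//; last exact: measurable_funTS.
  rewrite integral_cst// addeC ZE// leeD2l//.
  apply: ge0_subset_integral => //.
  - by apply: measurableI => //; exact: measurable_survival.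
  - exact: measurable_funTS.
  - by apply: setIS; exact: survivalS.
apply: ae_ge0_le_integral => //.
- by move=> w _; rewrite adde_ge0.
- by apply: emeasurable_funD => //; exact: measurable_funTS.
- by apply: measurable_funTS; exact: measurable_pos.
- by apply: filterS (survival_drift t) => w + [_ Sw]; exact.
Qed.

Lemma drift_telescope n A : <<s g_sigma_algebra_preimage (X 0%N) >> A ->
  \int[P]_(w in A `&` survival X n) pos n w
    + \sum_(0 <= t < n) delta%:E * P (A `&` survival X t)
  <= \int[P]_(w in A) pos 0%N w.
Proof.
move=> sA.
have mA := measurable_generated (@history_measurable _ _ _ _ X 0) _
  (initial_sub_history X 0 _ sA).
elim: n => [|n IH].
  rewrite big_geq// adde0; apply: ge0_subset_integral => //.
  - by apply: measurableI => //; exact: measurable_survival.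
  - by apply: measurable_funTS; exact: measurable_pos.
apply: le_trans IH; rewrite big_nat_recr//= (addeC (\sum_(_ <= _ < _) _)).
by rewrite addeA leeD2r// drift_step//; exact: initial_sub_history sA.
Qed.

(** Dropping the nonnegative remainder at time n from [drift_telescope] leaves
    a bound on the partial sums of E[T ; A] that does not depend on n. *)
Lemma integral_hitting_time_le A :
  <<s g_sigma_algebra_preimage (X 0%N) >> A ->
  \int[P]_(w in A) hitting_time X w
    <= \int[P]_(w in A) (delta^-1%:E * pos 0%N w).
Proof.
move=> sA.
have mA := measurable_generated (@history_measurable _ _ _ _ X 0) _
  (initial_sub_history X 0 _ sA).
rewrite ge0_integralZl//; last 2 first.
- by apply: measurable_funTS; exact: measurable_pos.
- by rewrite lee_fin invr_ge0 ltW.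
rewrite integral_hitting_time// lee_pdivlMl//.
rewrite -nneseriesZl//.
apply: lime_le.
  by apply: is_cvg_nneseries => t _ _; rewrite mule_ge0// lee_fin ltW.
apply: nearW => n; apply: le_trans (drift_telescope n A sA).
by rewrite leeDr// integral_ge0.
Qed.

End drift.

(** * The additive drift theorem *)

Theorem theorem5 (d : measure_display) (Omega : measurableType d)
    (R : realType) (P : probability Omega R) (X : nat -> {RV P >-> R})
    (delta : R)
    (Xge0 : forall t : nat,
      {ae P, forall w, t%:R%:E <= hitting_time X w -> (0 <= X t w)%R})
    (delta_gt0 : (0 < delta)%R)
    (drift : forall t : nat,
      {ae P, forall w, t%:R%:E < hitting_time X w ->
        (X t w)%:E - condexp P (history X t) (EFin \o X t.+1) w >= delta%:E}) :
  {ae P, forall w,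
    condexp P (g_sigma_algebra_preimage (X 0%N)) (hitting_time X) w
      <= (X 0%N w / delta)%:E}.
Proof.
set G := g_sigma_algebra_preimage (X 0%N).
have Gm : G `<=` measurable.
  by move=> A /sub_sigma_algebra/(initial_sub_history X 0)/measurable_generated;
    apply; exact: history_measurable.
have mT := measurable_hitting_time X.
have [Z0 mZ ZE] := ge0_condexpP P Gm mT (hitting_time_ge0 X).
have TE : (hitting_time X)^\+ = hitting_time X.
  apply/funext => w; rewrite funeposE; apply/max_idPl.
  exact: hitting_time_ge0.
have : {ae P, forall w, ge0_condexp P G (hitting_time X) w
    <= delta^-1%:E * (EFin \o X 0%N)^\+ w}.
  apply: (le_integral_ae_le P Gm) => //.
  - by move=> w; rewrite mule_ge0// lee_fin invr_ge0 ltW.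
  - apply: (@measurable_funeM _ (g_sigma_algebraType G)).
    apply: (@measurable_funepos _ (g_sigma_algebraType G)).
    apply/(@measurable_EFinP _ (g_sigma_algebraType G)) => _ B mB.
    by apply: sub_sigma_algebra; exists B.
  - move=> A sA; rewrite ZE//; exact: integral_hitting_time_le.
apply: filterS2 (Xge0 0%N) => w /(_ (hitting_time_ge0 X w)) X0 le_w.
have -> : (X 0%N w / delta)%:E = delta^-1%:E * (EFin \o X 0%N)^\+ w.
  by rewrite funeposE/= (max_idPl _) ?lee_fin// -EFinM mulrC.
(* Subtracting the conditional expectation of T^-, nonnegative everywhere, can
   only lower the left-hand side. *)
apply: le_trans le_w; rewrite /condexp TE -[leRHS]sube0 leeB//.
have [+ _ _] := ge0_condexpP P Gm (measurable_funeneg mT) (@funeneg_ge0 _ _ _).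
exact.
Qed.
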